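(* For every $\varepsilon>0$ and every integer $k\ge 2$, there exists a $C_{2k}$-free graph $G$ such that every bipartite subgraph of $G$ whose girth is greater than $2k$ has at most $\left(1-\frac{1}{2^{2k-2}}\right)\frac{2}{2k-1}\,e(G)\,(1+\varepsilon)$ edges.
   Context: $e(G)$ denotes the number of edges of a graph $G$. A graph is $C_{2k}$-free if it contains no cycle of length $2k$ as a subgraph. The girth of a graph is the length of a shortest cycle, and infinity if the graph has no cycle. *)

(* Defs.v *)
From mathcomp Require Import all_boot all_order all_algebra.
From mathcomp Require Export reals.
Set Implicit Arguments. Unset Strict Implicit. Unset Printing Implicit Defensive.

Section Graphs.
Variable V : finType.

Definition simple_graph (E : {set {set V}}) : Prop :=
  forall x, x \in E -> #|x| = 2.

Definition nedges (E : {set {set V}}) : nat := #|E|.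

(* H is a subgraph of G (same vertex set; isolated vertices do not affect
   edge count, bipartiteness or girth). *)
Definition subgraph (H E : {set {set V}}) : Prop := H \subset E.

Definition has_cycle (E : {set {set V}}) (L : nat) : Prop :=
  3 <= L /\ exists f : 'I_L -> V,
    injective f /\ forall i : 'I_L, [set f i; f (ordS i)] \in E.

Definition C_free (E : {set {set V}}) (L : nat) : Prop := ~ has_cycle E L.

(* girth > m : the shortest cycle (if any) has length > m
   (girth = infinity when there is no cycle). *)
Definition girth_gt (E : {set {set V}}) (m : nat) : Prop :=
  forall L, has_cycle E L -> m < L.

Definition bipartite (E : {set {set V}}) : Prop :=
  exists c : V -> bool, forall x y, [set x; y] \in E -> c x != c y.

End Graphs.

(* Main.v *)
Require Import Defs.
From mathcomp Require Import all_boot all_order all_algebra.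
From mathcomp Require Import reals.
From mathcomp Require Import zify ring lra.
Import Order.TTheory GRing.Theory Num.Theory.
Set Implicit Arguments. Unset Strict Implicit. Unset Printing Implicit Defensive.

(** Let [r = 2k - 1]. [G] is a union of edge-disjoint [r]-cliques, one for each
    hyperedge of an [r]-uniform hypergraph without short cycles; every cycle of
    length at most [2k] of [G] lies inside one clique, so [G] is [C_{2k}]-free and
    [H] is a forest in each clique: it has at most [r - 1] edges there, and none
    if the clique is monochromatic in the 2-colouring of [H]. It remains to make
    sure that each of the [2^n] colourings leaves at most a fraction
    [(1 - 2^(1-r)) (1 + eps)] of the [m] cliques non-monochromatic.
    This is a derandomised Chernoff bound: hyperedges are added one by one, so
    as to control the potential [sum_c (1 + z)^(number of cliques not monochromatic
    in c)]. A uniformly random [r]-tuple multiplies it by at most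
    [1 + (1 - 2^(1-r)) z] on average. An [r]-tuple can be added if its vertices
    have bounded degree and are pairwise at distance at least [2k]; when [n] and
    the degree bound are large, this excludes only a small proportion of them. *)

(** * Balls, and adding a clique without creating a cycle of given length *)

Section Neighbourhoods.
Variable V : finType.
Implicit Types (E : {set {set V}}) (A K : {set V}).

Definition nb E x : {set V} := [set y | [set x; y] \in E].
Definition ball E l x : {set V} :=
  iter l (fun A => A :|: \bigcup_(y in A) nb E y) [set x].
Definition clique K : {set {set V}} :=
  [set B : {set V} | (B \subset K) && (#|B| == 2)].

Lemma ball_center E l x : x \in ball E l x.
Proof. by elim: l => [|l IH] /=; rewrite inE ?IH. Qed.

Lemma ball_step E l x y z :
  y \in ball E l x -> [set y; z] \in E -> z \in ball E l.+1 x.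
Proof.
move=> yb yz; rewrite /= inE; apply/orP; right.
by apply/bigcupP; exists y => //; rewrite inE.
Qed.

Lemma subset_ball E x l1 l2 : l1 <= l2 -> ball E l1 x \subset ball E l2 x.
Proof.
move=> /subnK <-; elim: (l2 - l1) => [|d IH] //=.
by apply: subset_trans IH _; rewrite /= subsetUl.
Qed.

Lemma walk_ball E (g : nat -> V) i d :
  (forall t, i <= t < i + d -> [set g t; g t.+1] \in E) ->
  g (i + d) \in ball E d (g i).
Proof.
elim: d => [|d IH] gE; first by rewrite addn0 inE.
rewrite addnS; apply: (@ball_step _ _ _ (g (i + d))).
  by apply: IH => t ?; apply: gE; lia.
by apply: gE; lia.
Qed.

Lemma card_bigcup_le (I T : finType) (P : pred I) (F : I -> {set T}) :
  #|\bigcup_(i | P i) F i| <= \sum_(i | P i) #|F i|.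
Proof.
apply: (big_ind2 (fun (X : {set T}) n => #|X| <= n)) => //.
  by rewrite cards0.
move=> X1 n1 X2 n2 h1 h2; apply: leq_trans (leq_add h1 h2).
exact: leq_card_setU.
Qed.

Lemma card_ball E D l x :
  (forall y, #|nb E y| <= D) -> #|ball E l x| <= D.+1 ^ l.
Proof.
move=> hD; elim: l => [|l IH]; first by rewrite cards1.
apply: leq_trans (leq_card_setU _ _) _.
rewrite -/(ball E l x) expnS mulSn; apply: leq_add => //.
apply: leq_trans (card_bigcup_le _ _) _.
apply: (@leq_trans (\sum_(i in ball E l x) D)); first exact: leq_sum.
by rewrite sum_nat_const mulnC leq_mul2l IH orbT.
Qed.

Lemma nbU E1 E2 x : nb (E1 :|: E2) x = nb E1 x :|: nb E2 x.
Proof. by apply/setP=> y; rewrite !inE. Qed.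

Lemma clique_mem K x y : [set x; y] \in clique K -> (x \in K) /\ (y \in K).
Proof. by rewrite inE subUset !sub1set => /andP[/andP[]]. Qed.

Lemma nb_clique_out K x : x \notin K -> nb (clique K) x = set0.
Proof.
move=> xK; apply/setP=> y; rewrite !in_set.
apply/negbTE/negP => /andP[].
by rewrite subUset !sub1set (negbTE xK).
Qed.

Lemma nb_clique_sub K x : nb (clique K) x \subset K.
Proof. by apply/subsetP=> y; rewrite inE => /clique_mem[]. Qed.

Lemma sum_nb_clique K : \sum_x #|nb (clique K) x| <= #|K| * #|K|.
Proof.
rewrite -sum_nat_const [leqRHS]big_mkcond leq_sum //= => x _.
case: ifPn => xK; first exact/subset_leq_card/nb_clique_sub.
by rewrite nb_clique_out ?cards0.
Qed.

(* A cycle using both old and new edges contains a maximal run of old edges,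
   which is a short old walk between two distinct vertices of [K]. *)
Lemma C_free_clique E K L :
  C_free E L -> #|K| < L ->
  (forall x y, x \in K -> y \in K -> x != y -> y \notin ball E L.-1 x) ->
  C_free (clique K :|: E) L.
Proof.
move=> fE KL far [L3 [f [finj fcyc]]].
have [allE|] := boolP [forall i, [set f i; f (ordS i)] \in E].
  by apply: fE; split=> //; exists f; split=> // i; apply: (forallP allE).
rewrite negb_forall => /existsP[i0 i0E].
have L0 : 0 < L by lia.
(* The cycle is reindexed to start just after the new edge at [i0]: [g 0], ..., [g L.-1] lists its
   vertices and the closing edge is new. *)
pose h t : 'I_L := Ordinal (ltn_pmod (i0.+1 + t) L0).
pose g t := f (h t).
have hS t : ordS (h t) = h t.+1.
  by apply/val_inj; rewrite /= addnS -addn1 modnDml addn1.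
have gC t : [set g t; g t.+1] \in clique K :|: E by rewrite /g -hS.
have gnew t : [set g t; g t.+1] \notin E -> (g t \in K) /\ (g t.+1 \in K).
  by move=> tE; move: (gC t); rewrite inE (negbTE tE) orbF => /clique_mem.
have ginj t u : t < L -> u < L -> g t = g u -> t = u.
  move=> tL uL /finj /(congr1 val) /= /eqP.
  by rewrite eqn_modDl !modn_small // => /eqP.
have hlast : h L.-1 = i0.
  apply/val_inj => /=; rewrite -[RHS](modn_small (ltn_ord i0)).
  by rewrite (_ : _ + _ = i0 + L) ?modnDr //; lia.
have lastE : [set g L.-1; g L] \notin E.
  by rewrite /g -{2}(prednK L0) -hS hlast.
have hL : g L = g 0 by congr f; apply/val_inj; rewrite /= addn0 modnDr.
have lastK : g L.-1 \in K.
  by move: (gnew L.-1); rewrite prednK // => /(_ lastE)[].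
have g0K : g 0 \in K.
  by move: (gnew L.-1); rewrite prednK // hL -hL => /(_ lastE)[]; rewrite hL.
(* If every edge were new, all [L] vertices would lie in [K]. *)
have [noE|] := boolP [forall t : 'I_L, [set g t; g t.+1] \notin E].
  have : #|[set g t | t : 'I_L]| <= #|K|.
    apply/subset_leq_card/subsetP => _ /imsetP[t _ ->].
    by case: (gnew t) => //; apply: (forallP noE).
  rewrite card_imset ?card_ord; first by lia.
  by move=> t u tu; apply/val_inj/(ginj _ _ (ltn_ord t) (ltn_ord u) tu).
rewrite negb_forall => /existsP[t]; rewrite negbK => tE.
have tL : t < L.-1.
  have [te|] := eqVneq (t : nat) L.-1; last by move: (ltn_ord t); lia.
  by move: tE; rewrite te prednK // (negbTE lastE).
(* The run of old edges around [t] is extended backwards, then forwards, until it meets [K]; this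
   happens at the latest at [g 0] and [g L.-1]. *)
have left_end d : d <= t -> exists2 i, i <= d &
    g i \in K /\ forall u, i <= u < d -> [set g u; g u.+1] \in E.
  elim: d => [|d IH] dt; first by exists 0 => //; split=> // u; lia.
  have [dE|/gnew[_ ?]] := boolP ([set g d; g d.+1] \in E); last first.
    by exists d.+1 => //; split=> // u; lia.
  have [|i id [iK iE]] := IH; first by lia.
  exists i; first by lia.
  split=> // u ud; have [->//|ne] := eqVneq u d.
  by apply: iE; lia.
have right_end d : d < L.-1 - t -> exists2 j, L.-1 - d <= j < L &
    g j \in K /\ forall u, L.-1 - d <= u < j -> [set g u; g u.+1] \in E.
  elim: d => [|d IH] dt; first by exists L.-1; [lia|split=> // u; lia].
  have [dE|/gnew[? _]] := boolP ([set g (L.-1 - d.+1); g (L.-1 - d.+1).+1] \in E);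
    last by exists (L.-1 - d.+1); [lia|split=> // u; lia].
  have [|j jd [jK jE]] := IH; first by lia.
  exists j; first by lia.
  split=> // u ud; have [->//|ne] := eqVneq u (L.-1 - d.+1).
  by apply: jE; lia.
have [i it [iK iE]] := left_end t (leqnn _).
have [|j jt [jK jE]] := right_end (L.-1 - t.+1); first by lia.
have ne : g i != g j by apply/eqP => /ginj; lia.
have := far _ _ iK jK ne; apply/negP; rewrite negbK.
have ij : i + (j - i) = j by lia.
apply: (subsetP (@subset_ball _ _ (j - i) _ _)); first by lia.
rewrite -{1}ij; apply: walk_ball => u ui.
have [ut|ut|->] := ltngtP u t => //; [apply: iE|apply: jE]; lia.
Qed.

End Neighbourhoods.

(** * Acyclic graphs have fewer edges than vertices *)

Section Forests.
Variable V : finType.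
Implicit Types (E : {set {set V}}).

Let adj E : rel V := fun x y => [set x; y] \in E.

Lemma cycle_has_cycle E (p : seq V) :
  cycle (adj E) p -> uniq p -> 3 <= size p -> has_cycle E (size p).
Proof.
case: p => [|x p] // cp up sp; split=> //.
exists (fun i => nth x (x :: p) i); split.
  by move=> i j /eqP; rewrite nth_uniq // => /eqP/val_inj.
move=> i; move/(pathP x): cp => /(_ i); rewrite size_rcons => /(_ (ltn_ord i)).
rewrite /adj -rcons_cons nth_rcons ltn_ord.
suff -> : nth x (rcons p x) i = nth x (x :: p) (ordS i) by [].
rewrite nth_rcons /=; have /= := ltn_ord i; rewrite ltnS leq_eqVlt.
case/orP=> [/eqP ->|ip]; first by rewrite ltnn eqxx modnn.
by rewrite ip modn_small.
Qed.

Lemma subgraph_has_cycle E1 E2 L : E1 \subset E2 -> has_cycle E1 L -> has_cycle E2 L.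
Proof.
move=> /subsetP sE [L3 [f [finj fE]]]; split=> //; exists f; split=> // i.
exact/sE/fE.
Qed.


(* A duplicate-free path is extended at its head until this closes a cycle. *)
Lemma min_degree2_has_cycle E x0 (A : {set V}) :
  simple_graph E -> (forall B, B \in E -> B \subset A) -> x0 \in A ->
  (forall x, x \in A -> 1 < #|nb E x|) -> exists L, has_cycle E L.
Proof.
move=> sE EA x0A deg.
have ext n : (exists L, has_cycle E L) \/
    exists x p, [/\ x \in A, path (adj E) x p, uniq (x :: p) & size p = n].
  elim: n => [|n [?|[x [p [xA xp up sp]]]]]; [|by left|].
    by right; exists x0, [::].
  have adjne y z : adj E y z -> y != z.
    by move=> /sE yz; apply/eqP => eyz; move: yz; rewrite eyz setUid cards1.
  (* Avoiding the successor of [x] on the path makes the cycle closed by a repeated [z] have length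
     at least 3. For empty [p], [head] defaults to [x], which is no neighbour of itself. *)
  have [z [zx zp]] : exists z, adj E x z /\ z != head x p.
    have := deg x xA; rewrite (cardsD1 (head x p)) => h.
    have : 0 < #|nb E x :\ head x p| by move: h; case: (_ \in _) => /=; lia.
    by case/card_gt0P => z; rewrite !inE => /andP[? ?]; exists z.
  have zA : z \in A by move/EA: (zx); rewrite subUset !sub1set => /andP[].
  have symzx : adj E z x by rewrite /adj setUC.
  have [zin|zout] := boolP (z \in p); last first.
    right; exists z, (x :: p); split=> //=.
    - by rewrite symzx.
    - by rewrite inE negb_or eq_sym (adjne _ _ zx) zout; move: up => /= ->.
    - by rewrite sp.
  left; move: zp xp up; case/splitPr: zin => p1 p2.
  rewrite cat_path /= => zp /and3P[xp1 p1z _] /andP[].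
  rewrite mem_cat inE !negb_or => /and3P[xp1' xz _].
  rewrite cat_uniq /= negb_or => /and3P[up1 /andP[zp1 _] _].
  exists (size (x :: rcons p1 z)); apply: cycle_has_cycle => /=.
  - by rewrite !rcons_path xp1 p1z last_rcons.
  - by rewrite rcons_uniq zp1 up1 mem_rcons inE negb_or xz xp1'.
  - by rewrite size_rcons; case: p1 zp {xp1 p1z xp1' up1 zp1} => //=; rewrite eqxx.
case: (ext #|V|) => // -[x [p [_ _ up sp]]].
by have := max_card (mem (x :: p)); rewrite (card_uniqP up) /= sp ltnn.
Qed.

(** Some vertex has degree at most 1, since otherwise there is a cycle; deleting it removes at most
    one edge, and induction on [#|A|] applies. *)
Lemma acyclic_card E (A : {set V}) : (0 < #|A|)%N -> simple_graph E ->
  (forall B, B \in E -> B \subset A) -> (forall L, ~ has_cycle E L) -> #|E| < #|A|.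
Proof.
move En: #|A| => n; elim: n E A En => // n IH E A An _ sE EA nocyc.
have [/existsP[x /andP[xA degx]]|] :=
    boolP [exists x, (x \in A) && (#|nb E x| <= 1)]; last first.
  rewrite negb_exists => /forallP deg; have /card_gt0P[x0 x0A] : 0 < #|A| by lia.
  have [|L /nocyc//] := @min_degree2_has_cycle E x0 A sE EA x0A.
  by move=> x xA; have := deg x; rewrite xA /= -ltnNge.
have [n0|n0] := posnP n.
  suff -> : E = set0 by rewrite cards0.
  apply/setP=> B; rewrite inE; apply/negbTE/negP => BE.
  by have := subset_leq_card (EA _ BE); rewrite (sE _ BE) An n0.
pose E1 := [set B in E | x \in B].
have E1nb : #|E1| <= #|nb E x|.
  apply: leq_trans (leq_imset_card (fun y => [set x; y]) _).
  apply/subset_leq_card/subsetP => B; rewrite inE => /andP[BE xB].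
  have /eqP/cards2P[a [b [ab Bab]]] := sE _ BE.
  move: xB BE; rewrite Bab in_set2 => /orP[] /eqP -> BE.
    by apply/imsetP; exists b; rewrite ?inE.
  by apply/imsetP; exists a; rewrite ?inE setUC.
have : #|E :\: E1| < n.
  apply: (IH _ (A :\ x)) => //.
  - by move: (cardsD1 x A); rewrite xA An; lia.
  - by move=> B /setDP[/sE].
  - move=> B /setDP[BE]; rewrite inE BE /= => xB.
    by rewrite subsetD1 EA.
  - move=> L /(subgraph_has_cycle (subsetDl _ _)); exact: nocyc.
have -> : #|E| = #|E1| + #|E :\: E1|.
  by rewrite -(cardsID E1 E) (setIidPr _) //; apply/subsetP => B; rewrite inE => /andP[].
lia.
Qed.

End Forests.

(** * Unions of cliques along a list of tuples *)

Section CliqueUnion.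
Variables (V : finType) (r : nat).
Implicit Types (e : {ffun 'I_r -> V}) (s : seq {ffun 'I_r -> V}).
Implicit Types (E H : {set {set V}}) (c : V -> bool).

Definition verts e : {set V} := [set e i | i : 'I_r].

Definition clique_union s : {set {set V}} :=
  foldr (fun e E => clique (verts e) :|: E) set0 s.

(** The condition on pairs also makes the entries distinct, since a ball contains its centre. *)
Definition admissible E (l D : nat) e : bool :=
  [forall i, (#|nb E (e i)| <= D) &&
    [forall j, (i != j) ==> (e j \notin ball E l (e i))]].

(** The list grows at its head: the tail holds the tuples added earlier. *)
Fixpoint greedy (l D : nat) s : bool :=
  if s is e :: s' then admissible (clique_union s') l D e && greedy l D s'
  else true.

Definition nonmono c e : bool := [exists i, exists j, c (e i) != c (e j)].

Lemma card_verts_le e : #|verts e| <= r.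
Proof. by apply: leq_trans (leq_imset_card _ _) _; rewrite card_ord. Qed.

Lemma admissible_inj E l D e : admissible E l D e -> injective e.
Proof.
move=> /forallP adm i j eij; apply/eqP/negPn/negP => ij.
have /andP[_ /forallP/(_ j)] := adm i.
by rewrite ij -eij ball_center.
Qed.

Lemma card_verts E l D e : admissible E l D e -> #|verts e| = r.
Proof. by move/admissible_inj => ei; rewrite card_imset // card_ord. Qed.

Lemma sum_nb_clique_union s :
  \sum_x #|nb (clique_union s) x| <= size s * (r * r).
Proof.
elim: s => [|e s IH] /=.
  by rewrite big1 // => x _; apply: eq_card0 => y; rewrite !inE.
apply: (@leq_trans (\sum_x (#|nb (clique (verts e)) x| + #|nb (clique_union s) x|))).
  by apply: leq_sum => x _; rewrite nbU leq_card_setU.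
rewrite big_split mulSn leq_add //.
apply: leq_trans (sum_nb_clique _) _.
by rewrite leq_mul // card_verts_le.
Qed.

(** A new clique raises only the degrees of its own vertices, which were at most [D] before, and by
    at most [r]. *)
Lemma greedy_degree l D s x : greedy l D s -> #|nb (clique_union s) x| <= D + r.
Proof.
elim: s => [|e s IH] /= => [_|/andP[adm /IH le]].
  by rewrite eq_card0 // => y; rewrite !inE.
rewrite nbU; have [/imsetP[i _ ->]|xe] := boolP (x \in verts e); last first.
  by rewrite nb_clique_out // set0U.
apply: leq_trans (leq_card_setU _ _) _; rewrite addnC leq_add //.
  by have /forallP/(_ i)/andP[] := adm.
exact: leq_trans (subset_leq_card (nb_clique_sub _ _)) (card_verts_le e).
Qed.

Lemma greedy_C_free L D s :
  r < L -> greedy L.-1 D s -> C_free (clique_union s) L.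
Proof.
move=> rL; elim: s => [|e s IH] /= => [_|/andP[adm /IH fs]].
  move=> [L3 [f [_ fE]]]; have L0 : 0 < L by lia.
  by have := fE (Ordinal L0); rewrite inE.
apply: C_free_clique => //; first exact: leq_ltn_trans (card_verts_le e) rL.
move=> _ _ /imsetP[i _ ->] /imsetP[j _ ->] eij.
have /forallP/(_ i)/andP[_ /forallP/(_ j)/implyP] := adm; apply.
by apply: contraNneq eij => ->.
Qed.

Lemma clique_union_simple s : simple_graph (clique_union s).
Proof.
elim: s => [|e s IH] /= B; first by rewrite inE.
by rewrite inE => /orP[|/IH//]; rewrite inE => /andP[_ /eqP].
Qed.

(** The cliques are edge-disjoint: an old edge joining two entries of the new tuple would put one in
    the ball of radius 1 of the other. *)
Lemma card_clique_union l D s : 0 < l -> greedy l D s ->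
  #|clique_union s| = size s * 'C(r, 2).
Proof.
move=> l0; elim: s => [|e s IH] /= => [_|/andP[adm /IH eqs]]; first by rewrite cards0.
rewrite cardsU eqs [X in _ - X]eq_card0 ?subn0; last first.
  move=> B; rewrite !inE; apply/negP => /andP[/andP[Be /cards2P[x [y [xy Bxy]]]] Bs].
  move: Be Bs; rewrite Bxy subUset !sub1set.
  case/andP=> /imsetP[i _ xi] /imsetP[j _ yj] Bs.
  have /forallP/(_ i)/andP[_ /forallP/(_ j)/implyP] := adm.
  have -> : i != j by apply: contraNneq xy => ij; rewrite xi yj ij.
  move=> /(_ isT)/negP; apply; rewrite -xi -yj.
  apply: (subsetP (@subset_ball _ _ _ 1 l l0)).
  by apply: (@ball_step _ _ 0 _ x) => //; rewrite inE.
by rewrite mulSn cards_draws (card_verts adm).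
Qed.

Lemma card_proper_forest c H s L : 0 < r -> r <= L ->
  simple_graph H -> (forall x y, [set x; y] \in H -> c x != c y) ->
  girth_gt H L ->
  #|H :&: clique_union s| <= r.-1 * count (nonmono c) s.
Proof.
move=> r0 rL sH cH gH; elim: s => [|e s IH] /=; first by rewrite setI0 cards0.
rewrite setIUr mulnDr; apply: leq_trans (leq_card_setU _ _) (leq_add _ IH).
have [_|mono] := boolP (nonmono c e); last first.
  rewrite muln0 leqn0 cards_eq0 -subset0; apply/subsetP => B.
  rewrite !inE => /andP[BH /andP[Be /cards2P[x [y [_ Bxy]]]]].
  move: Be BH; rewrite Bxy subUset !sub1set.
  case/andP=> /imsetP[i _ ->] /imsetP[j _ ->] /cH cij.
  by apply: contraNT mono => _; apply/existsP; exists i; apply/existsP; exists j.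
have e0 : 0 < #|verts e|.
  by apply/card_gt0P; exists (e (Ordinal r0)); apply/imsetP; exists (Ordinal r0).
rewrite muln1; suff : #|H :&: clique (verts e)| < #|verts e|.
  by move=> h; have := card_verts_le e; lia.
apply: acyclic_card => //.
- by move=> B; rewrite inE => /andP[/sH].
- by move=> B; rewrite !inE => /and3P[].
(* A cycle of [H] in the clique has more than [L >= r] vertices, too many for the clique. *)
move=> M cyc; have : L < M.
  by apply: gH; apply: subgraph_has_cycle cyc; apply: subsetIl.
case: cyc => M3 [f [finj fE]].
have : #|[set f i | i : 'I_M]| <= #|verts e|.
  apply/subset_leq_card/subsetP => _ /imsetP[i _ ->].
  by have := fE i; rewrite inE => /andP[_ /clique_mem[]].
by rewrite card_imset // card_ord; have := card_verts_le e; lia.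
Qed.

End CliqueUnion.

(** Convexity of the power function, free of division. The induction step is Chebyshev's inequality:
    [a - b] and [a ^ n - b ^ n] have the same sign. *)
Lemma expn_mean a b r : (a + b) ^ r.+1 <= 2 ^ r * (a ^ r.+1 + b ^ r.+1).
Proof.
elim: r => [|r IH]; first by rewrite !expn1 mul1n.
rewrite [leqLHS]expnS; apply: (@leq_trans ((a + b) * (2 ^ r * (a ^ r.+1 + b ^ r.+1)))).
  by rewrite leq_mul2l IH orbT.
rewrite [2 ^ r.+1]expnS mulnCA [2 * _]mulnC -mulnA leq_mul2l; apply/orP; right.
rewrite [a ^ r.+2]expnS [b ^ r.+2]expnS.
have [ab|/ltnW ab] := leqP a b.
  have : a ^ r.+1 <= b ^ r.+1 by rewrite leq_exp2r.
  by nia.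
have : b ^ r.+1 <= a ^ r.+1 by rewrite leq_exp2r.
by nia.
Qed.

(** * Counting tuples, and the average growth of the potential *)

Section Counting.
Variables (V : finType) (r : nat).
Implicit Types (e : {ffun 'I_r -> V}) (s : seq {ffun 'I_r -> V}).
Implicit Types (E H : {set {set V}}) (c : V -> bool).

Lemma card_familyE (F : 'I_r -> {set V}) :
  #|[set e : {ffun 'I_r -> V} | [forall i, e i \in F i]]| = \prod_i #|F i|.
Proof.
transitivity #|family F|.
  by apply: eq_card => e; rewrite inE.
by rewrite card_family foldrE big_map big_enum.
Qed.

Lemma prod_cardT : \prod_(i < r) #|V| = #|V| ^ r.
Proof. by rewrite prod_nat_const card_ord. Qed.

Lemma card_coord i (S : {set V}) :
  #|[set e : {ffun 'I_r -> V} | e i \in S]| * #|V| = #|S| * #|V| ^ r.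
Proof.
pose F j := if j == i then S else setT.
have -> : [set e : {ffun 'I_r -> V} | e i \in S] =
          [set e : {ffun 'I_r -> V} | [forall j, e j \in F j]].
  apply/setP => e; rewrite !inE; apply/idP/forallP => [eS j|/(_ i)].
    by rewrite /F; case: eqP => [->|]; rewrite ?inE.
  by rewrite /F eqxx.
rewrite card_familyE -prod_cardT (bigD1 i) //= [in RHS](bigD1 i) //= {1}/F eqxx.
rewrite -mulnA; congr (_ * _); rewrite mulnC; congr (_ * _).
by apply: eq_bigr => j /negbTE ji; rewrite /F ji cardsT.
Qed.

(** Tuples are split by the value [x] of [e i]; once it is fixed, [e j] has at most [B] choices and
    the other entries are free. *)
Lemma card_coord2 i j (F : V -> {set V}) B : i != j ->
  (forall x, #|F x| <= B) ->
  #|[set e : {ffun 'I_r -> V} | e j \in F (e i)]| * #|V| <= B * #|V| ^ r.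
Proof.
move=> ij FB; have ji : j != i by rewrite eq_sym.
have [V0|V0] := posnP #|V|; first by rewrite V0 muln0.
pose A x := [set e : {ffun 'I_r -> V} | (e i == x) && (e j \in F x)].
have cardA x : #|A x| * (#|V| * #|V|) <= B * #|V| ^ r.
  pose G l := if l == i then [set x] else if l == j then F x else setT.
  have -> : A x = [set e : {ffun 'I_r -> V} | [forall l, e l \in G l]].
    apply/setP => e; rewrite !inE; apply/andP/forallP => [[/eqP ex eF] l|eG].
      rewrite /G; case: eqP => [->|_]; first by rewrite inE ex.
      by case: eqP => [->|]; rewrite ?inE.
    move: (eG i) (eG j); rewrite /G eqxx (negbTE ji) eqxx inE => -> ->.
    by [].
  rewrite card_familyE -prod_cardT (bigD1 i) //= (bigD1 j) //=.
  rewrite [in leqRHS](bigD1 i) //= [in leqRHS](bigD1 j) //=.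
  rewrite {1 2}/G !eqxx (negbTE ji) cards1 mul1n.
  rewrite [X in #|F x| * X](eq_bigr (fun=> #|V|)); last first.
    by move=> l /andP[/negbTE li /negbTE lj]; rewrite /G li lj cardsT.
  by rewrite -mulnA leq_mul // mulnC mulnA.
rewrite -(leq_pmul2r V0) -mulnA.
have -> : [set e : {ffun 'I_r -> V} | e j \in F (e i)] = \bigcup_x A x.
  apply/setP => e; rewrite inE; apply/idP/bigcupP => [eF|[x _]].
    by exists (e i); rewrite ?inE ?eqxx.
  by rewrite inE => /andP[/eqP ->].
apply: (@leq_trans ((\sum_x #|A x|) * (#|V| * #|V|))).
  by rewrite leq_mul2r card_bigcup_le orbT.
rewrite big_distrl /=; apply: (@leq_trans (\sum_(x : V) B * #|V| ^ r)).
  exact: leq_sum.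
by rewrite sum_nat_const mulnC.
Qed.

(** Union bound: one of [r] entries has large degree, or one of at most [r * r] pairs is too
    close. *)
Lemma card_not_admissible E l D B : (forall x, #|ball E l x| <= B) ->
  #|[set e : {ffun 'I_r -> V} | ~~ admissible E l D e]| * #|V| <=
  (r * #|[set x | D < #|nb E x|]| + r * r * B) * #|V| ^ r.
Proof.
move=> hB; pose S := [set x | D < #|nb E x|].
pose X i := [set e : {ffun 'I_r -> V} | e i \in S].
pose Y i j := [set e : {ffun 'I_r -> V} | (i != j) && (e j \in ball E l (e i))].
have sub : [set e : {ffun 'I_r -> V} | ~~ admissible E l D e] \subset
    (\bigcup_i X i) :|: \bigcup_i \bigcup_j Y i j.
  apply/subsetP => e; rewrite !inE negb_forall => /existsP[i].
  rewrite negb_and negb_forall => /orP[h|/existsP[j]].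
    by apply/orP; left; apply/bigcupP; exists i; rewrite // !inE ltnNge.
  rewrite negb_imply negbK => h; apply/orP; right.
  by apply/bigcupP; exists i => //; apply/bigcupP; exists j; rewrite ?inE.
apply: leq_trans (leq_mul (subset_leq_card sub) (leqnn _)) _.
apply: leq_trans (leq_mul (leq_card_setU _ _) (leqnn _)) _.
rewrite !mulnDl; apply: leq_add.
  apply: leq_trans (leq_mul (card_bigcup_le _ _) (leqnn _)) _.
  rewrite big_distrl /= (eq_bigr (fun=> #|S| * #|V| ^ r)) => [|i _]; last first.
    exact: card_coord.
  by rewrite sum_nat_const card_ord mulnA.
apply: leq_trans (leq_mul (card_bigcup_le _ _) (leqnn _)) _.
rewrite big_distrl /=; apply: (@leq_trans (\sum_(i < r) r * B * #|V| ^ r)); last first.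
  by rewrite sum_nat_const card_ord !mulnA.
apply: leq_sum => i _.
apply: leq_trans (leq_mul (card_bigcup_le _ _) (leqnn _)) _.
rewrite big_distrl /=; apply: (@leq_trans (\sum_(j < r) B * #|V| ^ r)); last first.
  by rewrite sum_nat_const card_ord !mulnA.
apply: leq_sum => j _; rewrite /Y; case: eqP => /= [_|/eqP ij].
  by rewrite (_ : [set _ | false] = set0) ?cards0 //; apply/setP => e; rewrite !inE.
exact: card_coord2.
Qed.

(** Colour classes of sizes [a] and [b] give [a ^ r + b ^ r] monochromatic tuples, and convexity
    bounds this below by its value at [a = b]. *)
Lemma card_monochromatic c : 0 < r ->
  #|V| ^ r <= 2 ^ r.-1 * #|[set e : {ffun 'I_r -> V} | ~~ nonmono c e]|.
Proof.
move=> r0; pose P b := [set x | c x == b].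
pose M b := [set e : {ffun 'I_r -> V} | [forall i, e i \in P b]].
have cM b : #|M b| = #|P b| ^ r.
  by rewrite card_familyE prod_nat_const card_ord.
have sub : M true :|: M false \subset [set e | ~~ nonmono c e].
  apply/subsetP => e eM; rewrite inE; apply/existsP => -[i /existsP[j]].
  move: eM; rewrite !inE => /orP[] /forallP h.
    by move: (h i) (h j); rewrite !inE => /eqP -> /eqP ->.
  by move: (h i) (h j); rewrite !inE => /eqP -> /eqP ->.
apply: leq_trans (leq_mul (leqnn _) (subset_leq_card sub)).
rewrite cardsU [X in _ - X]eq_card0 ?subn0 => [|e]; last first.
  rewrite !inE; apply/negP => /andP[/forallP/(_ (Ordinal r0)) h1 /forallP/(_ (Ordinal r0))].
  by move: h1; rewrite !inE => /eqP ->.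
have -> : #|V| = #|P true| + #|P false|.
  rewrite -(cardC (P true)); congr (_ + _); apply: eq_card => x.
  by rewrite !inE; case: (c x).
by rewrite !cM -{1 3 4}(prednK r0) expn_mean.
Qed.

Local Open Scope ring_scope.
Variable R : realType.
Implicit Types z eta : R.

Definition potential z s : R :=
  \sum_(c : {ffun V -> bool}) (1 + z) ^+ count (nonmono c) s.

Let p0 : R := 1 - (2 ^+ r.-1)^-1.

Lemma card_nonmono c : (0 < r)%N ->
  #|[set e : {ffun 'I_r -> V} | nonmono c e]|%:R <= p0 * #|V|%:R ^+ r.
Proof.
move=> r0; have := card_monochromatic c r0.
have cT : (#|[set e : {ffun 'I_r -> V} | nonmono c e]| +
      #|[set e : {ffun 'I_r -> V} | ~~ nonmono c e]| = #|V| ^ r)%N.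
  rewrite -[in RHS](card_ord r) -card_ffun -[RHS](cardsC [set e | nonmono c e]).
  by congr (_ + _)%N; apply: eq_card => e; rewrite !inE.
rewrite -natrX -cT -(ler_nat R) natrM natrD natrX => h.
have T0 : 0 < (2 ^+ r.-1)^-1 :> R by rewrite invr_gt0 exprn_gt0.
have := ler_wpM2l (ltW T0) h; rewrite mulKf ?expf_neq0 ?pnatr_eq0 // /p0.
lra.
Qed.

Lemma potential_ge0 z s : 0 <= z -> 0 <= potential z s.
Proof. by move=> z0; apply: sumr_ge0 => c _; rewrite exprn_ge0 // addr_ge0. Qed.

Lemma potential_gt0 z s : 0 <= z -> 0 < potential z s.
Proof.
move=> z0; rewrite /potential (bigD1 [ffun=> true]) //= ltr_wpDr //.
  by apply: sumr_ge0 => c _; rewrite exprn_ge0 // addr_ge0.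
by rewrite exprn_gt0 // ltr_pwDl.
Qed.

(** After exchanging the sums, a tuple multiplies the term of a colouring by [1 + z] or by 1, and at
    most a fraction [p0] of the tuples does the former. *)
Lemma sum_potential z s : (0 < r)%N -> 0 <= z ->
  \sum_e potential z (e :: s) <= #|V|%:R ^+ r * (1 + p0 * z) * potential z s.
Proof.
move=> r0 z0; rewrite /potential exchange_big mulr_sumr /=.
apply: ler_sum => c _.
rewrite (eq_bigr (fun e => (1 + z *+ nonmono c e) * (1 + z) ^+ count (nonmono c) s)).
  rewrite -mulr_suml ler_wpM2r ?exprn_ge0 ?addr_ge0 //.
  rewrite big_split /= sumr_const card_ffun card_ord -natrX.
  rewrite mulrDr mulr1 lerD2l.
  rewrite (eq_bigr (fun e => (nonmono c e)%:R * z)) => [|e _]; last first.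
    by rewrite mulr_natl.
  rewrite -mulr_suml mulrA ler_wpM2r //.
  have := card_nonmono c r0.
  rewrite mulrC -sum1_card natr_sum big_mkcond /= natrX; congr (_ <= _).
  by apply: eq_bigr => e _; rewrite inE; case: (nonmono c e).
by move=> e _; rewrite exprD; case: (nonmono c e); rewrite ?mulr0n ?addr0 ?mulr1n.
Qed.

End Counting.

Local Open Scope ring_scope.

(** * The greedy construction under potential control *)

Section Greedy.
Variables (R : realType) (V : finType) (r : nat).
Implicit Types (e : {ffun 'I_r -> V}) (s : seq {ffun 'I_r -> V}).
(** Here [m] is the number of tuples wanted, [q] the growth of the potential allowed per step, and
    [eta] a bound on the fraction of inadmissible tuples. The terms of [few_bad] account for
    vertices of large degree and for close pairs. *)
Variables (l D m : nat) (z q eta : R).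
Hypothesis r_gt0 : (0 < r)%N.
Hypothesis D_gt0 : (0 < D)%N.
Hypothesis V_gt0 : (0 < #|V|)%N.
Hypothesis z_ge0 : 0 <= z.
Hypothesis q_ge0 : 0 <= q.
Hypothesis growth : 1 + (1 - (2 ^+ r.-1)^-1) * z < (1 - eta) * q.
Hypothesis few_bad : (r * (r * r) * m)%:R / D%:R +
  (r * r * (D + r).+1 ^ l)%:R <= eta * #|V|%:R.

(* Saturated vertices are few because the total degree is at most [m * r ^ 2]. *)
Lemma card_admissible s : greedy l D s -> (size s <= m)%N ->
  (1 - eta) * #|V|%:R ^+ r <=
  #|[set e : {ffun 'I_r -> V} | admissible (clique_union s) l D e]|%:R.
Proof.
move=> gs sm; set E := clique_union s; pose S := [set x | (D < #|nb E x|)%N].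
have hB x : (#|ball E l x| <= (D + r).+1 ^ l)%N.
  by apply: card_ball => y; apply: greedy_degree gs.
have SD : (#|S| * D <= m * (r * r))%N.
  apply: (@leq_trans (\sum_x #|nb E x|)).
    rewrite -sum_nat_const [leqRHS](bigID (mem S)) /=.
    by apply: leq_trans (leq_addr _ _); apply: leq_sum => x; rewrite inE => /ltnW.
  by apply: leq_trans (sum_nb_clique_union _) _; rewrite leq_mul2r sm orbT.
have := card_not_admissible r D hB; rewrite -/S.
have := cardsC [set e : {ffun 'I_r -> V} | admissible E l D e].
rewrite card_ffun card_ord.
have -> : ~: [set e : {ffun 'I_r -> V} | admissible E l D e] =
          [set e : {ffun 'I_r -> V} | ~~ admissible E l D e].
  by apply/setP => e; rewrite !inE.
set ga := #|[set _ | _]|; set bad := #|[set _ | _]| => /(congr1 (fun n => n%:R : R)).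
rewrite natrD natrX => gb hbad.
have V0 : 0 < #|V|%:R :> R by rewrite ltr0n.
have D0 : 0 < D%:R :> R by rewrite ltr0n.
suff : bad%:R <= eta * #|V|%:R ^+ r by move: gb; lra.
rewrite -(ler_pM2r V0); move: hbad; rewrite -(ler_nat R) !natrM natrX => /le_trans; apply.
rewrite mulrAC ler_wpM2r ?exprn_ge0 //; apply: le_trans few_bad.
rewrite natrD lerD2r ler_pdivlMr // -natrM ler_nat -!mulnA leq_mul2l.
by apply/orP; right; rewrite [(r * m)%N]mulnC mulnCA.
Qed.

(** Averaging: if every admissible tuple exceeded the factor [q], these tuples alone, a fraction at
    least [1 - eta] of all, would by [growth] exceed the bound of [sum_potential] on the total. *)
Lemma greedy_step s : greedy l D s -> (size s <= m)%N -> exists e,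
  greedy l D (e :: s) /\ potential z (e :: s) <= q * potential z s.
Proof.
move=> gs sm.
have [/existsP[e /andP[adm le]]|] := boolP [exists e,
    admissible (clique_union s) l D e && (potential z (e :: s) <= q * potential z s)].
  by exists e; rewrite /= adm gs.
rewrite negb_exists => /forallP noe; exfalso.
have Phi0 : 0 < potential z s by apply: potential_gt0.
have V0 : 0 < #|V|%:R ^+ r :> R by rewrite exprn_gt0 // ltr0n.
have := sum_potential s r_gt0 z_ge0; apply/negP; rewrite -ltNge.
apply: (@lt_le_trans _ _ ((1 - eta) * #|V|%:R ^+ r * (q * potential z s))).
  rewrite [ltRHS](_ : _ = #|V|%:R ^+ r * ((1 - eta) * q) * potential z s); last by ring.
  by rewrite ltr_pM2r // ltr_pM2l.
apply: le_trans (ler_wpM2r _ (card_admissible gs sm)) _.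
  by rewrite mulr_ge0 // ltW.
rewrite [leRHS](bigID (admissible (clique_union s) l D)) /=.
rewrite -[leLHS]addr0 lerD //; last first.
  by apply: sumr_ge0 => e _; apply: potential_ge0.
rewrite mulr_natl -sumr_const big_mkcond [leRHS]big_mkcond /=; apply: ler_sum => e _.
rewrite inE; case: ifP => // adm; have := noe e; rewrite adm /= -ltNge; exact: ltW.
Qed.

Lemma greedy_exists t : (t <= m)%N -> exists s,
  [/\ greedy l D s, size s = t & potential z s <= 2 ^+ #|V| * q ^+ t].
Proof.
elim: t => [|t IH] tm.
  exists [::]; split => //; rewrite /potential /= expr0 mulr1.
  by rewrite (eq_bigr (fun=> 1)) // sumr_const card_ffun card_bool natrX.
have [s [gs st ps]] := IH (ltnW tm).
have [|e [ge pe]] := greedy_step gs; first by rewrite st ltnW.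
exists (e :: s); split=> //=; first by rewrite st.
by apply: le_trans pe _; rewrite exprS mulrCA ler_wpM2l.
Qed.

End Greedy.

(** * Exponential inequalities for the choice of parameters *)

Section Growth.
Variable R : realType.
Implicit Types x z p A B : R.

Lemma bernoulli_ge x n : 0 <= x -> 1 + n%:R * x <= (1 + x) ^+ n.
Proof.
move=> x0; elim: n => [|n IH]; first by rewrite mul0r addr0.
have n0 : 0 <= n%:R * (x * x) by rewrite !mulr_ge0.
rewrite exprS; apply: le_trans (ler_wpM2l _ IH); last by rewrite addr_ge0.
rewrite -natr1; lra.
Qed.

(** An upper bound for the power, kept free of division; the induction uses [(1 + x) * (1 - n.+1%:R
    * x) <= 1 - n%:R * x]. *)
Lemma bernoulli_le x n : 0 <= x -> (1 + x) ^+ n * (1 - n%:R * x) <= 1.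
Proof.
move=> x0; elim: n => [|n IH]; first by rewrite mul0r subr0 mulr1.
apply: le_trans IH; rewrite exprSr -mulrA ler_wpM2l ?exprn_ge0 ?addr_ge0 //.
have n0 : 0 <= n%:R * (x * x) by rewrite !mulr_ge0.
have x2 : 0 <= x * x by rewrite mulr_ge0.
rewrite -natr1; lra.
Qed.

(** To first order at [z = 0] the two sides are [1 + b p z] and [1 + a z], so a small [z] separates
    them. *)
Lemma exp_growth_gap p (a b : nat) : 0 <= p -> b%:R * p < a%:R ->
  exists2 z, 0 < z & (1 + p * z) ^+ b < (1 + z) ^+ a.
Proof.
move=> p0 bpa; pose d := a%:R - b%:R * p; pose c := a%:R * (b%:R * p).
have d0 : 0 < d by rewrite /d; lra.
have bp0 : 0 <= b%:R * p by rewrite mulr_ge0.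
have c0 : 0 <= c by rewrite mulr_ge0.
have c1 : 0 < c + 1 by lra.
(* This choice gives [c * z < d], which makes the product in [prod1] exceed 1. *)
pose z := d / (c + 1); have z0 : 0 < z by rewrite divr_gt0.
exists z => //; apply: lt_le_trans (bernoulli_ge _ (ltW z0)).
have zd : (c + 1) * z = d by rewrite mulrC divfK // gt_eqF.
have prod1 : 1 < (1 + a%:R * z) * (1 - b%:R * (p * z)).
  rewrite [ltRHS](_ : _ = 1 + z * (d - c * z)); last by rewrite /d /c; ring.
  by rewrite ltrDl mulr_gt0 // -zd; lra.
have az1 : 0 < 1 + a%:R * z by rewrite ltr_pwDl // mulr_ge0 // ltW.
have pos : 0 < 1 - b%:R * (p * z).
  by rewrite -(pmulr_rgt0 _ az1) (lt_trans ltr01).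
rewrite -(ltr_pM2r pos); apply: le_lt_trans prod1.
by apply: bernoulli_le; rewrite mulr_ge0 // ltW.
Qed.

(** The factor 2, raised to the power [n], will absorb the number of colourings. Bernoulli applies
    once [M] exceeds the inverse of [B / A - 1]. *)
Lemma exp_ratio_gt2 A B : 0 < A -> A < B -> exists M, 2 * A ^+ M < B ^+ M.
Proof.
move=> A0 AB; pose x := B / A - 1.
have BA : B / A = 1 + x by rewrite /x; ring.
have x0 : 0 < x by rewrite subr_gt0 ltr_pdivlMr // mul1r.
exists (Num.truncn x^-1).+1.
rewrite -ltr_pdivlMr ?exprn_gt0 // -expr_div_n BA.
apply: lt_le_trans (bernoulli_ge _ (ltW x0)).
have := truncnS_gt x^-1; rewrite -(ltr_pM2r x0) mulVf ?gt_eqF //; lra.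
Qed.

End Growth.

(** * Choice of parameters and conclusion *)

Theorem theorem3 (R : realType) (eps : R) (k : nat) :
  0 < eps -> (2 <= k)%N ->
  exists (n : nat) (E : {set {set 'I_n}}),
    [/\ simple_graph E, (0 < nedges E)%N, C_free E (2 * k) &
     forall H : {set {set 'I_n}},
       subgraph H E -> bipartite H -> girth_gt H (2 * k) ->
       (nedges H)%:R <=
         (1 - ((2 ^+ (2 * k - 2))%:R)^-1) * (2 / ((2 * k - 1)%N)%:R)
           * (nedges E)%:R * (1 + eps) :> R].
Proof.
move=> eps0 k2; set r := (2 * k - 1)%N.
have r_gt1 : (1 < r)%N by rewrite /r; lia.
have r_gt0 := ltnW r_gt1.
have r_lt : (r < 2 * k)%N by rewrite /r; lia.
pose l := (2 * k).-1; have l_gt0 : (0 < l)%N by rewrite /l; lia.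
have -> : (2 * k - 2)%N = r.-1 by rewrite /r; lia.
have -> : (2 ^+ r.-1)%R%:R = 2 ^+ r.-1 :> R by rewrite natrX.
set p0 : R := 1 - _.
have p0_gt0 : 0 < p0.
  rewrite subr_gt0 invf_lt1 ?exprn_gt0 // exprn_egt1 ?ltr1n //.
  by rewrite -lt0n -subn1 subn_gt0.
(* Half of [eps] pays for the inadmissible tuples, the other half for the Chernoff bound. *)
pose p1 := p0 * (1 + eps / 2).
have p1_gt0 : 0 < p1 by rewrite mulr_gt0 //; lra.
have p01 : p0 < p1 by rewrite /p1 mulrDr mulr1 ltrDl mulr_gt0 // divr_gt0.
have pe0 : 0 < p0 * eps / 2 by rewrite divr_gt0 // mulr_gt0.
(* With this [b] an integer [a] fits between [b * p1] and [b * (p0 * (1 + eps))], so the target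
   fraction becomes the rational [a / b]. *)
pose b := (Num.truncn (p0 * eps / 2)^-1).+1.
have hb : 1 < b%:R * (p0 * eps / 2).
  by rewrite -ltr_pdivrMr // mul1r; exact: truncnS_gt.
pose a := Num.truncn (b%:R * (p0 * (1 + eps))).
have ab0 : 0 <= b%:R * (p0 * (1 + eps)).
  by rewrite mulr_ge0 // mulr_ge0 ?ltW // addr_gt0.
have /andP[a_le a_gt] := truncn_itv ab0; rewrite -/a in a_le a_gt.
have bpa : b%:R * p1 < a%:R by move: a_gt hb; rewrite -natr1 /p1; lra.
have [z z0 gap] := exp_growth_gap (ltW p1_gt0) bpa.
pose q := 1 + p1 * z.
have q_gt0 : 0 < q by rewrite ltr_pwDl // mulr_ge0 // ltW.
have [M hM] := exp_ratio_gt2 (exprn_gt0 b q_gt0) gap.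
have M0 : (0 < M)%N by case: (M) hM => //; rewrite !expr0; lra.
(* Half the relative gap between the average growth and [q], so that [growth] is strict. *)
pose eta := (1 - (1 + p0 * z) / q) / 2.
have eta_gt0 : 0 < eta.
  by rewrite divr_gt0 // subr_gt0 ltr_pdivrMr // mul1r ltrD2l ltr_pM2r.
have growth : 1 + p0 * z < (1 - eta) * q.
  have h : (1 + p0 * z) / q * q = 1 + p0 * z by rewrite divfK // gt_eqF.
  have : 0 < eta * q by rewrite mulr_gt0.
  have -> : (1 - eta) * q = 1 + p0 * z + eta * q.
    by rewrite -[X in _ = X + _]h /eta; field; rewrite gt_eqF.
  by rewrite ltrDl.
(* As [m] is linear in [n], [D] can be chosen from [W] and [eta] before [n]; then each term of
   [few_bad] is at most [eta * n / 2]. *)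
pose W := (r * (r * r) * (b * M))%N.
pose D := (Num.truncn (2 * W%:R / eta)).+1.
pose n := (Num.truncn (2 * (r * r * (D + r).+1 ^ l)%:R / eta)).+1.
pose m := (b * M * n)%N.
have m_gt0 : (0 < m)%N by rewrite !muln_gt0 M0.
have few_bad : (r * (r * r) * m)%:R / D%:R +
    (r * r * (D + r).+1 ^ l)%:R <= eta * #|'I_n|%:R.
  rewrite card_ord.
  have hD : 2 * W%:R / eta < D%:R by exact: truncnS_gt.
  have hn : 2 * (r * r * (D + r).+1 ^ l)%:R / eta < n%:R by exact: truncnS_gt.
  move: hD hn; rewrite !ltr_pdivrMr // => hD hn.
  suff : (r * (r * r) * m)%:R / D%:R <= eta * n%:R / 2 by move: hn; lra.
  rewrite ler_pdivrMr ?ltr0n // /m mulnA natrM -/W.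
  have n0 : 0 <= n%:R :> R by [].
  have := ler_wpM2l n0 (ltW hD); lra.
have D_gt0 : (0 < D)%N by [].
have n_gt0 : (0 < n)%N by [].
clearbody n; clearbody D.
have Vn : (0 < #|'I_n|)%N by rewrite card_ord.
have [s [gs sm ps]] := greedy_exists r_gt0 D_gt0 Vn (ltW z0) (ltW q_gt0)
  growth few_bad (leqnn m).
have z1 : 1 <= 1 + z by rewrite lerDl ltW.
have count_le (c : {ffun 'I_n -> bool}) :
    (count (nonmono c) s)%:R <= p0 * (1 + eps) * m%:R.
  set X := count _ _.
  have Xp : (1 + z) ^+ X <= 2 ^+ n * q ^+ m.
    move: ps; rewrite card_ord; apply: le_trans.
    rewrite /potential (bigD1 c) //= lerDl; apply: sumr_ge0 => c' _.
    by rewrite exprn_ge0 // (le_trans ler01).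
  (* Otherwise [(1 + z) ^+ (a * M * n) <= 2 ^+ n * q ^+ m], against the [n]-th power of [hM]. *)
  have XaMn : (X < a * M * n)%N.
    rewrite ltnNge; apply/negP => /(ler_weXn2l z1) /le_trans/(_ Xp).
    apply/negP; rewrite -ltNge /m !exprM -exprMn ltrXn2r -?lt0n //.
    by rewrite mulr_ge0 // !exprn_ge0 // ltW.
  apply: (@le_trans _ _ (a * M * n)%:R); first by rewrite ler_nat ltnW.
  rewrite /m !natrM !mulrA ler_wpM2r // ler_wpM2r //.
  by rewrite mulrC in a_le.
exists n, (clique_union s); split.
- exact: clique_union_simple.
- by rewrite /nedges (card_clique_union l_gt0 gs) sm muln_gt0 bin_gt0 r_gt1 m_gt0.
- exact: greedy_C_free r_lt gs.
move=> H HE [c cH] gH; rewrite /nedges.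
have sH : simple_graph H by move=> B /(subsetP HE); exact: clique_union_simple.
have cH' x y : [set x; y] \in H -> [ffun x => c x] x != [ffun x => c x] y.
  by rewrite !ffunE; exact: cH.
have := card_proper_forest s r_gt0 (ltnW r_lt) sH cH' gH.
rewrite (setIidPl HE) -(ler_nat R) natrM => /le_trans; apply.
rewrite (card_clique_union l_gt0 gs) sm natrM.
have r0 : 0 < r%:R :> R by rewrite ltr0n.
have -> : 'C(r, 2)%:R = r%:R * r.-1%:R / 2 :> R.
  apply: (canRL (mulfK _)); first by rewrite pnatr_eq0.
  by rewrite -!natrM -[2%N]/(2`!) bin_ffact ffactnS ffactn1.
(* The factor [2 / r] of the bound turns the [r (r - 1) / 2] edges of a clique into the [r - 1]
   edges of a spanning tree. *)
rewrite [leRHS](_ : _ = r.-1%:R * (p0 * (1 + eps) * m%:R)).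
  by rewrite ler_wpM2l.
by field; rewrite gt_eqF.
Qed.
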